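(* Let $R$ be a commutative ring with unit. For all integers $l,r\geq 0$, the functors shift and décalage give a Quillen equivalence $$S^l:(\mathbf{F}\mathrm{C}_R,I_r,J_r,\mathcal{E}_r)\rightleftarrows(\mathbf{F}\mathrm{C}_R,I_{l+r},J_{l+r},\mathcal{E}_{l+r}):\mathrm{Dec}^l,$$ with $S^l$ the left adjoint, where for $k\ge0$, $(\mathbf{F}\mathrm{C}_R,I_k,J_k,\mathcal{E}_k)$ denotes the category of filtered complexes of $R$-modules with the cofibrantly generated model structure whose weak equivalences are the class $\mathcal{E}_k$ of $E_k$-quasi-isomorphisms, whose set of generating cofibrations is $I_k$ and whose set of generating trivial cofibrations is $J_k$.
   Context: Complexes are cochain complexes, unbounded. A filtered $R$-module $(A,F)$ is an $R$-module $A$ with submodules $F_pA$, $p\in\mathbb{Z}$, such that $F_{p-1}A\subseteq F_pA$ (no boundedness condition). A filtered complex $(A,d,F)$ is a cochain complex $(A,d)$ of $R$-modules with a filtration $F$ of each $A^n$ such that $d(F_pA^n)\subseteq F_pA^{n+1}$ for all $p,n\in\mathbb{Z}$; morphisms are morphisms of complexes with $f(F_pA^n)\subseteq F_pB^n$; the category is $\mathbf{F}\mathrm{C}_R$. The $l$-shift of $(A,d,F)$ is $(A,d,S^lF)$ with $S^lF_pA^n=F_{p+ln}A^n$; the $l$-décalage is $(A,d,\mathrm{Dec}^lF)$ with $\mathrm{Dec}^lF_pA^n=F_{p-ln}A^n\cap d^{-1}(F_{p-l(n+1)}A^{n+1})$. Both are functors $\mathbf{F}\mathrm{C}_R\to\mathbf{F}\mathrm{C}_R$,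 the identity on morphisms, and $S^l$ is left adjoint to $\mathrm{Dec}^l$. For a filtered complex $A$ put $Z_k^{p,n+p}(A)=F_pA^n\cap d^{-1}(F_{p-k}A^{n+1})$, $B_0^{p,n+p}(A)=Z_0^{p-1,n+p-1}(A)$ and $B_k^{p,n+p}(A)=Z_{k-1}^{p-1,n+p-1}(A)+dZ_{k-1}^{p+k-1,n+p+k-2}(A)$ for $k\ge1$. The $k$-th page of the associated spectral sequence is $E_k^{p,q}(A)=Z_k^{p,q}(A)/B_k^{p,q}(A)$ with differential $\delta_k[a]=[da]$ of bidegree $(-k,1-k)$. A morphism $f$ is an $E_k$-quasi-isomorphism if $E_k(f)$ induces an isomorphism on cohomology with respect to $\delta_k$ (i.e. $E_{k+1}(f)$ is an isomorphism). $R^n_{(p)}$ denotes $R$ in degree $n$, pure of weight $p$ (i.e. $F_{p-1}=0$, $F_p=R$). For $k\ge0$, $\mathcal{Z}_k(p,n)=\big(R^n_{(p)}\xrightarrow{1}R^{n+1}_{(p-k)}\big)$. For $k\geq1$, $\mathcal{B}_k(p,n)=\big(R^{n-1}_{(p+k-1)}\xrightarrow{x\mapsto(x,0)}R^n_{(p)}\oplus R^n_{(p-1)}\xrightarrow{(x,y)\mapsto y}R^{n+1}_{(p-k)}\big)$, and $\varphi_k:\mathcal{Z}_k(p,n)\to\mathcal{B}_k(p,n)$ is $x\mapsto(x,x)$ in degree $n$ and the identity in degree $n+1$. Then $I_k=\{\varphi_{k+1}:\mathcal{Z}_{k+1}(p,n)\to\mathcal{B}_{k+1}(p,n)\}_{p,n\in\mathbb{Z}}$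 and $J_k=\{0\to\mathcal{Z}_k(p,n)\}_{p,n\in\mathbb{Z}}$. In this model structure (whose existence for every $k\ge0$ may be assumed) the fibrations are the morphisms $f$ such that $Z_k(f)$ is bidegree-wise surjective. *)

(* Defs.v *)
From HB Require Import structures.
From mathcomp Require Import all_boot all_order all_algebra.
From mathcomp Require Import generic_quotient ring_quotient.
From mathcomp Require Import boolp zify.

Set Implicit Arguments.
Unset Strict Implicit.
Unset Printing Implicit Defensive.

Import Order.TTheory GRing.Theory Num.Theory.
Local Open Scope ring_scope.
Local Open Scope quotient_scope.

#[local] Obligation Tactic := idtac.

Declare Scope cat_scope.
Delimit Scope cat_scope with cat.

(** * Categories, adjunctions, model structures *)

Record category := Category {
  obj :> Type;
  hom : obj -> obj -> Type;
  idm : forall X, hom X X;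
  cmp : forall X Y Z, hom Y Z -> hom X Y -> hom X Z;
  cmp1m : forall X Y (f : hom X Y), cmp (idm Y) f = f;
  cmpm1 : forall X Y (f : hom X Y), cmp f (idm X) = f;
  cmpA : forall X Y Z T (h : hom Z T) (g : hom Y Z) (f : hom X Y),
    cmp h (cmp g f) = cmp (cmp h g) f }.

Arguments hom {c} X Y.
Arguments idm {c} X.
Arguments cmp {c X Y Z} g f.

Notation "X ~> Y" := (hom X Y) (at level 60, no associativity) : cat_scope.
Notation "g ∘ f" := (cmp g f) (at level 40, left associativity) : cat_scope.
Local Open Scope cat_scope.

Record functor (C D : category) := Functor {
  fobj :> C -> D;
  fhom : forall X Y : C, X ~> Y -> fobj X ~> fobj Y;
  fhom1 : forall X : C, fhom (idm X) = idm (fobj X);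
  fhomM : forall (X Y Z : C) (g : Y ~> Z) (f : X ~> Y),
    fhom (g ∘ f) = fhom g ∘ fhom f }.

Arguments fhom {C D} f {X Y} _ : rename.

(* [F] is left adjoint to [G] *)
Record adjunction (C D : category) (F : functor C D) (G : functor D C) :=
  Adjunction {
    adj : forall (X : C) (Y : D), F X ~> Y -> X ~> G Y;
    adj_bij : forall (X : C) (Y : D), bijective (@adj X Y);
    adj_natl : forall (X X' : C) (Y : D) (h : F X ~> Y) (u : X' ~> X),
      adj (h ∘ fhom F u) = adj h ∘ u;
    adj_natr : forall (X : C) (Y Y' : D) (v : Y ~> Y') (h : F X ~> Y),
      adj (v ∘ h) = fhom G v ∘ adj h }.

Arguments adj {C D F G} _ {X Y} h.

Section ModelStructures.
Variable C : category.

Definition morphism_class := forall X Y : C, X ~> Y -> Prop.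
Implicit Types P Q : morphism_class.

Definition initial (Z : C) :=
  forall X : C, exists f : Z ~> X, forall g : Z ~> X, g = f.

Definition terminal (T : C) :=
  forall X : C, exists f : X ~> T, forall g : X ~> T, g = f.

Definition has_lift (A B X Y : C) (i : A ~> B) (p : X ~> Y) :=
  forall (u : A ~> X) (v : B ~> Y), p ∘ u = v ∘ i ->
    exists h : B ~> X, h ∘ i = u /\ p ∘ h = v.

(* right lifting property with respect to [P] (the class P-inj) *)
Definition rlp P : morphism_class := fun X Y p =>
  forall (A B : C) (i : A ~> B), P A B i -> has_lift i p.

Definition meet_class P Q : morphism_class := fun X Y f => P X Y f /\ Q X Y f.

Definition retract (X Y X' Y' : C) (f : X ~> Y) (g : X' ~> Y') :=
  exists (i : X ~> X') (r : X' ~> X) (j : Y ~> Y') (s : Y' ~> Y),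
    [/\ r ∘ i = idm X, s ∘ j = idm Y, g ∘ i = j ∘ f & f ∘ r = s ∘ g].

Definition retract_closed P :=
  forall (X Y X' Y' : C) (f : X ~> Y) (g : X' ~> Y'),
    retract f g -> P X' Y' g -> P X Y f.

Definition subcategory P :=
  (forall X : C, P X X (idm X)) /\
  (forall (X Y Z : C) (g : Y ~> Z) (f : X ~> Y),
     P X Y f -> P Y Z g -> P X Z (g ∘ f)).

Definition two_of_three P :=
  forall (X Y Z : C) (g : Y ~> Z) (f : X ~> Y),
    [/\ P X Y f -> P Y Z g -> P X Z (g ∘ f),
        P X Y f -> P X Z (g ∘ f) -> P Y Z g
      & P Y Z g -> P X Z (g ∘ f) -> P X Y f].

Definition factors P Q := forall (X Y : C) (f : X ~> Y),
  exists (W : C) (i : X ~> W) (p : W ~> Y), [/\ P X W i, Q W Y p & f = p ∘ i].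

Record model_structure := ModelStructure {
  weq : morphism_class;
  cof : morphism_class;
  fib : morphism_class;
  weq_subcat : subcategory weq;
  cof_subcat : subcategory cof;
  fib_subcat : subcategory fib;
  weq_2of3 : two_of_three weq;
  weq_retract : retract_closed weq;
  cof_retract : retract_closed cof;
  fib_retract : retract_closed fib;
  cof_tfib_lift : forall (A B X Y : C) (i : A ~> B) (p : X ~> Y),
    cof i -> meet_class fib weq p -> has_lift i p;
  tcof_fib_lift : forall (A B X Y : C) (i : A ~> B) (p : X ~> Y),
    meet_class cof weq i -> fib p -> has_lift i p;
  cof_tfib_fact : factors cof (meet_class fib weq);
  tcof_fib_fact : factors (meet_class cof weq) fib }.

(* [M] has weak equivalences [E], generating cofibrations [I] and generating
   trivial cofibrations [J]. These conditions determine the three classes of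
   [M]; smallness of the domains of [I] and [J] is a property of the sets [I]
   and [J] in [C], not of [M], and is left out. *)
Definition cofibrantly_generated_by (M : model_structure)
    (I J E : morphism_class) :=
  [/\ forall (X Y : C) (f : X ~> Y), weq M f <-> E X Y f,
      forall (X Y : C) (f : X ~> Y), fib M f <-> rlp J f
    & forall (X Y : C) (f : X ~> Y),
        meet_class (fib M) (weq M) f <-> rlp I f].

Definition cofibrant (M : model_structure) (X : C) :=
  exists (Z : C) (f : Z ~> X), initial Z /\ cof M f.

Definition fibrant (M : model_structure) (X : C) :=
  exists (T : C) (f : X ~> T), terminal T /\ fib M f.

End ModelStructures.

Arguments weq {C} m {X Y} f : rename.
Arguments cof {C} m {X Y} f : rename.
Arguments fib {C} m {X Y} f : rename.

Section QuillenEquivalence.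
Variables (C D : category) (F : functor C D) (G : functor D C).
Variables (MC : model_structure C) (MD : model_structure D).

Definition left_quillen :=
  (forall (X Y : C) (f : X ~> Y), cof MC f -> cof MD (fhom F f)) /\
  (forall (X Y : C) (f : X ~> Y), cof MC f /\ weq MC f ->
     cof MD (fhom F f) /\ weq MD (fhom F f)).

Definition quillen_equivalence (phi : adjunction F G) :=
  left_quillen /\
  forall (X : C) (Y : D) (f : F X ~> Y), cofibrant MC X -> fibrant MD Y ->
    (weq MD f <-> weq MC (adj phi f)).

End QuillenEquivalence.

(** * Subquotients of modules *)

Section Subquotient.
Variables (R : pzRingType) (V : lmodType R).

Definition submod (Z : submodClosed V) := {x : V | x \in Z}.
HB.instance Definition _ (Z : submodClosed V) := SubChoice.on (submod Z).
HB.instance Definition _ (Z : submodClosed V) :=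
  [SubChoice_isSubLmodule of submod Z by <:].

Variables Z B : submodClosed V.

Definition submod_pred : {pred submod Z} := [pred u | val u \in B].
Lemma submod_pred_closed : zmod_closed submod_pred.
Proof.
split=> [|u v]; rewrite !inE; first by rewrite GRing.val0 rpred0.
by move=> Bu Bv; rewrite GRing.valB -scaleN1r rpredD ?rpredZ.
Qed.
HB.instance Definition _ :=
  GRing.isZmodClosed.Build (submod Z) submod_pred submod_pred_closed.

(* Z / (B :&: Z), where [B] is contained in [Z] in all uses below *)
Definition subquot := Quotient.quot submod_pred.
HB.instance Definition _ := GRing.Zmodule.on subquot.

Definition cls (u : submod Z) : subquot := \pi_(Quotient.quot submod_pred) u.

Lemma cls_eq u v : cls u = cls v <-> val u - val v \in B.
Proof.
split=> [/eqP|h]; first by rewrite -Quotient.idealrBE inE GRing.valB.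
by apply/eqP; rewrite -Quotient.idealrBE inE GRing.valB.
Qed.

Lemma cls_surj x : exists u, x = cls u.
Proof. by exists (repr x); rewrite /cls reprK. Qed.

Lemma clsD u v : cls (u + v) = cls u + cls v.
Proof. exact: raddfD. Qed.

Definition sq_scale (a : R) (x : subquot) : subquot := cls (a *: repr x).

Lemma sq_scaleE a u : sq_scale a (cls u) = cls (a *: u).
Proof.
apply/cls_eq; rewrite !GRing.valZ -scalerBr rpredZ //.
by apply/cls_eq; rewrite {1}/cls reprK.
Qed.

Fact sq_scalerA a b x : sq_scale a (sq_scale b x) = sq_scale (a * b) x.
Proof. by have [u ->] := cls_surj x; rewrite !sq_scaleE scalerA. Qed.
Fact sq_scale1r : left_id 1 sq_scale.
Proof. by move=> x; have [u ->] := cls_surj x; rewrite sq_scaleE scale1r. Qed.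
Fact sq_scalerDr : right_distributive sq_scale +%R.
Proof.
move=> a x y; have [u ->] := cls_surj x; have [v ->] := cls_surj y.
by rewrite -clsD !sq_scaleE -clsD scalerDr.
Qed.
Fact sq_scalerDl x : {morph sq_scale^~ x : a b / a + b}.
Proof.
by move=> a b; have [u ->] := cls_surj x; rewrite !sq_scaleE -clsD scalerDl.
Qed.
HB.instance Definition _ := GRing.Zmodule_isLmodule.Build R subquot
  sq_scalerA sq_scale1r sq_scalerDr sq_scalerDl.

Fact cls_linear : linear cls.
Proof. by move=> a u v; rewrite clsD -sq_scaleE. Qed.
HB.instance Definition _ :=
  GRing.isLinear.Build R (submod Z) subquot _ cls cls_linear.

End Subquotient.

Arguments cls {R V Z B} u.

Section SubquotientMap.
Variables (R : pzRingType) (V W : lmodType R) (f : {linear V -> W}).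
Variables (Z B : submodClosed V) (Z' B' : submodClosed W).
Hypothesis fZ : forall x, x \in Z -> f x \in Z'.
Hypothesis fB : forall x, x \in B -> f x \in B'.

Definition submod_map (u : submod Z) : submod Z' :=
  exist _ (f (val u)) (fZ (valP u)).

Definition subquot_map of (forall x, x \in B -> f x \in B') :=
  fun x : subquot Z B => cls (submod_map (repr x)) : subquot Z' B'.

Lemma subquot_mapE u : subquot_map fB (cls u) = cls (submod_map u).
Proof.
apply/cls_eq; rewrite /= -raddfB; apply: fB.
by apply/cls_eq; rewrite {1}/cls reprK.
Qed.

Fact subquot_map_linear : linear (subquot_map fB).
Proof.
move=> a x y; have [u ->] := cls_surj x; have [v ->] := cls_surj y.
rewrite -linearP !subquot_mapE -linearP; congr cls.
by apply: val_inj; rewrite /= linearP.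
Qed.
HB.instance Definition _ := GRing.isLinear.Build R (subquot Z B)
  (subquot Z' B') _ (subquot_map fB) subquot_map_linear.

End SubquotientMap.

Section KerIm.
Variables (R : pzRingType) (V W : lmodType R) (f : {linear V -> W}).

Definition ker : {pred V} := [pred x | f x == 0].
Lemma ker_closed : submod_closed ker.
Proof.
split=> [|a x y]; rewrite !inE ?linear0 // => /eqP hx /eqP hy.
by rewrite linearP hx hy scaler0 addr0.
Qed.
HB.instance Definition _ := GRing.isSubmodClosed.Build R V ker ker_closed.

Definition im : {pred W} := [pred y | `[< exists x, y = f x >]].
Lemma im_closed : submod_closed im.
Proof.
split=> [|a _ _ /asboolP[x ->] /asboolP[y ->]]; apply/asboolP.
  by exists 0; rewrite linear0.
by exists (a *: x + y); rewrite linearP.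
Qed.
HB.instance Definition _ := GRing.isSubmodClosed.Build R W im im_closed.

End KerIm.

(** * Filtered complexes *)

Section FilteredComplexes.
Variable R : comPzRingType.

(* The differential is given in all bidegrees [i], [j] and vanishes unless
   [j = i + 1], so that no transport along equalities in [int] is needed. *)
Record fcomplex := FComplex {
  fc_mod :> int -> lmodType R;
  fc_d : forall i j, {linear fc_mod i -> fc_mod j};
  fc_filt : int -> forall n, {pred fc_mod n};
  fc_shape : forall (i j : int) (x : fc_mod i), j != i + 1 -> fc_d i j x = 0;
  fc_dd : forall (i j k : int) (x : fc_mod i), fc_d j k (fc_d i j x) = 0;
  fc_closed : forall p n : int, submod_closed (@fc_filt p n);
  fc_mono : forall (p n : int) (x : fc_mod n), x \in @fc_filt (p - 1) n -> x \in @fc_filt p n;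
  fc_dF : forall (p n : int) (x : fc_mod n),
    x \in @fc_filt p n -> fc_d n (n + 1) x \in @fc_filt p (n + 1) }.

Arguments fc_filt {f} p n : rename.
Arguments fc_d {f} i j : rename.

Local Notation d := fc_d.
Local Notation F := fc_filt.

HB.instance Definition _ (A : fcomplex) p n :=
  GRing.isSubmodClosed.Build R (A n) (F p n) (fc_closed A p n).

Lemma fc_le (A : fcomplex) p q n (x : A n) :
  p <= q -> x \in F p n -> x \in F q n.
Proof.
move=> pq Fx; have -> : q = p + `|q - p|%N%:Z.
  by rewrite gez0_abs ?subr_ge0 // subrKC.
elim: `|q - p|%N => [|m IH]; first by rewrite addr0.
by apply: fc_mono; rewrite intS addrCA addrAC subrr add0r.
Qed.

Lemma fc_dFj (A : fcomplex) p i j (x : A i) : x \in F p i -> d i j x \in F p j.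
Proof.
move=> Fx; have [->|ne] := eqVneq j (i + 1); first exact: fc_dF.
by rewrite fc_shape ?rpred0.
Qed.

Record fc_hom (A B : fcomplex) := FCHom {
  fc_map :> forall n, {linear A n -> B n};
  fc_map_d : forall (i j : int) (x : A i), fc_map j (d i j x) = d i j (fc_map i x);
  fc_map_F : forall (p n : int) (x : A n), x \in F p n -> fc_map n x \in F p n }.

Lemma linear_eq (V W : lmodType R) (f g : {linear V -> W}) : f =1 g -> f = g.
Proof.
case: f g => [f cf] [g cg] /= /funext fg; case: _ / fg in cg *.
congr GRing.Linear.Pack.
case: cf cg => [[a] [b]] [[a'] [b']].
by rewrite (Prop_irrelevance a a') (Prop_irrelevance b b').
Qed.

Lemma fc_hom_eq (A B : fcomplex) (f g : fc_hom A B) :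
  (forall n, f n =1 g n) -> f = g.
Proof.
case: f g => [f fd fF] [g gd gF] /= fg.
have {fg} e : f = g.
  by apply: functional_extensionality_dep => n; apply/linear_eq/fg.
case: _ / e in gd gF *.
by rewrite (Prop_irrelevance fd gd) (Prop_irrelevance fF gF).
Qed.

Definition fc_id (A : fcomplex) : fc_hom A A :=
  @FCHom A A (fun n => idfun) (fun _ _ _ => erefl) (fun _ _ _ Fx => Fx).

Program Definition fc_comp (A B C : fcomplex) (g : fc_hom B C) (f : fc_hom A B)
  : fc_hom A C := @FCHom A C (fun n => g n \o f n) _ _.
Next Obligation. by move=> A B C g f i j x /=; rewrite !fc_map_d. Qed.
Next Obligation. by move=> A B C g f p n x Fx; do 2!apply: fc_map_F. Qed.

Program Definition FC : category :=
  @Category fcomplex fc_hom fc_id fc_comp _ _ _.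
Next Obligation. by move=> A B f; apply: fc_hom_eq. Qed.
Next Obligation. by move=> A B f; apply: fc_hom_eq. Qed.
Next Obligation. by move=> A B C D h g f; apply: fc_hom_eq. Qed.

(** ** Shift and décalage *)

Program Definition shift (l : nat) (A : fcomplex) : fcomplex :=
  @FComplex A (@fc_d A) (fun p n => F (p + l%:Z * n) n)
    (@fc_shape A) (@fc_dd A) _ _ _.
Next Obligation. by move=> l A p n; apply: fc_closed. Qed.
Next Obligation.
by move=> l A p n x; apply: fc_le; rewrite lerD2r gerBl.
Qed.
Next Obligation.
move=> l A p n x /fc_dF; apply: fc_le.
by rewrite lerD2l mulrDr mulr1 lerDl.
Qed.

Definition dec_filt (l : nat) (A : fcomplex) (p n : int) : {pred A n} :=
  [pred x | (x \in F (p - l%:Z * n) n) &&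
            (d n (n + 1) x \in F (p - l%:Z * (n + 1)) (n + 1))].

Program Definition dec (l : nat) (A : fcomplex) : fcomplex :=
  @FComplex A (@fc_d A) (@dec_filt l A) (@fc_shape A) (@fc_dd A) _ _ _.
Next Obligation.
move=> l A p n; split=> [|a x y /andP[x1 x2] /andP[y1 y2]].
  by rewrite inE linear0 !rpred0.
by rewrite inE linearP /= !rpredD ?rpredZ.
Qed.
Next Obligation.
move=> l A p n x /andP[x1 x2]; apply/andP.
by split; [move: x1|move: x2]; apply: fc_le; rewrite lerD2r gerBl.
Qed.
Next Obligation.
by move=> l A p n x /andP[_ x2]; apply/andP; rewrite fc_dd rpred0.
Qed.

Program Definition shift_map (l : nat) (A B : fcomplex) (f : fc_hom A B) :
  fc_hom (shift l A) (shift l B) := @FCHom (shift l A) (shift l B) f _ _.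
Next Obligation. by move=> l A B f i j x; apply: (fc_map_d f). Qed.
Next Obligation. by move=> l A B f p n x; apply: (fc_map_F f). Qed.

Program Definition dec_map (l : nat) (A B : fcomplex) (f : fc_hom A B) :
  fc_hom (dec l A) (dec l B) := @FCHom (dec l A) (dec l B) f _ _.
Next Obligation. by move=> l A B f i j x; apply: (fc_map_d f). Qed.
Next Obligation.
move=> l A B f p n x /andP[x1 x2]; apply/andP.
split; first exact: (fc_map_F f x1).
by have := fc_map_F f x2; rewrite (fc_map_d f).
Qed.

Program Definition Shift (l : nat) : functor FC FC :=
  @Functor FC FC (shift l) (@shift_map l) _ _.
Next Obligation. by move=> l A; apply: fc_hom_eq. Qed.
Next Obligation. by move=> l A B C g f; apply: fc_hom_eq. Qed.

Program Definition Dec (l : nat) : functor FC FC :=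
  @Functor FC FC (dec l) (@dec_map l) _ _.
Next Obligation. by move=> l A; apply: fc_hom_eq. Qed.
Next Obligation. by move=> l A B C g f; apply: fc_hom_eq. Qed.

(* transposition along [Shift l -| Dec l] is the identity on the underlying
   morphisms of complexes *)
Program Definition shift_adj (l : nat) (A B : fcomplex)
  (f : fc_hom (shift l A) B) : fc_hom A (dec l B) := @FCHom A (dec l B) f _ _.
Next Obligation. by move=> l A B f i j x; apply: (fc_map_d f). Qed.
Next Obligation.
move=> l A B f p n x Fx; apply/andP; rewrite -(fc_map_d f).
by split; apply: (fc_map_F f); rewrite /= subrK //; apply: fc_dF.
Qed.

Program Definition shift_unadj (l : nat) (A B : fcomplex)
  (f : fc_hom A (dec l B)) : fc_hom (shift l A) B := @FCHom (shift l A) B f _ _.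
Next Obligation. by move=> l A B f i j x; apply: (fc_map_d f). Qed.
Next Obligation.
by move=> l A B f p n x /(fc_map_F f)/andP[]; rewrite addrK.
Qed.

Program Definition ShiftDec (l : nat) : adjunction (Shift l) (Dec l) :=
  @Adjunction FC FC (Shift l) (Dec l) (@shift_adj l) _ _ _.
Next Obligation.
by move=> l A B; exists (@shift_unadj l A B) => f; apply: fc_hom_eq.
Qed.
Next Obligation. by move=> l A A' B h u; apply: fc_hom_eq. Qed.
Next Obligation. by move=> l A B B' v h; apply: fc_hom_eq. Qed.

(** ** The spectral sequence

   The pages are indexed by the filtration degree [p] and the cohomological
   degree [n], so that [Zs k p n], [Bs k p n], [E k p n] are
   $Z_k^{p,n+p}$, $B_k^{p,n+p}$, $E_k^{p,n+p}$. *)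

Section SpectralSequence.
Variable A : fcomplex.

Definition Zs (k : nat) (p n : int) : {pred A n} :=
  [pred x | (x \in F p n) && (d n (n + 1) x \in F (p - k%:Z) (n + 1))].

Arguments Zs k p n : clear implicits.

Lemma Zs_closed k p n : submod_closed (Zs k p n).
Proof.
split=> [|a x y /andP[x1 x2] /andP[y1 y2]].
  by rewrite inE linear0 !rpred0.
by rewrite inE linearP /= !rpredD ?rpredZ.
Qed.
HB.instance Definition _ k p n :=
  GRing.isSubmodClosed.Build R (A n) (Zs k p n) (Zs_closed k p n).

Definition Bs (k : nat) (p n : int) : {pred A n} :=
  if k is m.+1 then
    [pred x | `[< exists z w, [/\ z \in Zs m (p - 1) n,
       w \in Zs m (p + k%:Z - 1) (n - 1) & x = z + d (n - 1) n w] >]]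
  else Zs 0 (p - 1) n.

Arguments Bs k p n : clear implicits.

Lemma Bs_closed k p n : submod_closed (Bs k p n).
Proof.
case: k => [|k]; first exact: Zs_closed.
split; first by apply/asboolP; exists 0, 0; rewrite !rpred0 linear0 addr0.
move=> a _ _ /asboolP[z [w [hz hw ->]]] /asboolP[z' [w' [hz' hw' ->]]].
apply/asboolP; exists (a *: z + z'), (a *: w + w').
by rewrite !rpredD ?rpredZ // linearP scalerDr addrACA.
Qed.
HB.instance Definition _ k p n :=
  GRing.isSubmodClosed.Build R (A n) (Bs k p n) (Bs_closed k p n).

Lemma Bs_sub_Zs k p n x : x \in Bs k p n -> x \in Zs k p n.
Proof.
case: k => [/andP[x1 x2]|k /asboolP[z [w [/andP[z1 z2] /andP[w1 w2] ->]]]].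
  by apply/andP; split; apply: fc_mono => //; rewrite addrAC.
apply/andP; rewrite linearD fc_dd addr0; split; last first.
  by move: z2; rewrite -addrA -opprD -intS.
rewrite rpredD //; first exact: fc_mono.
move: w2; have -> : p + k.+1%:Z - 1 - k%:Z = p.
  by rewrite intS addrA -!addrA; lia.
by rewrite subrK.
Qed.

Definition E (k : nat) (p n : int) : lmodType R :=
  subquot (Zs k p n) (Bs k p n).

(* [d] maps $Z_k^p$ to $Z_k^{p-k}$ and $B_k^p$ to $B_k^{p-k}$. The target
   filtration degree [p'] is tied to [p] by an equation, so that the
   differentials into and out of [E k p n] are both at hand. *)
Section Differential.
Variables (k : nat) (p p' i j : int) (pp' : p' = p - k%:Z).

Fact d_Zs x : x \in Zs k p i -> d i j x \in Zs k p' j.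
Proof.
have [->|ne _] := eqVneq j (i + 1); last by rewrite fc_shape ?rpred0.
by move=> /andP[_ x2]; apply/andP; rewrite fc_dd rpred0 pp'.
Qed.

Fact d_Bs x : x \in Bs k p i -> d i j x \in Bs k p' j.
Proof.
have [->|ne _] := eqVneq j (i + 1); last by rewrite fc_shape ?rpred0.
have ii : i + 1 - 1 = i by rewrite addrK.
rewrite pp'; case: k => [/andP[x1 x2]|m /asboolP[z [w [hz hw ->]]]].
  by apply/andP; rewrite fc_dd rpred0 !subr0 in x2 *.
apply/asboolP; rewrite linearD fc_dd addr0 ii.
by exists 0, z; rewrite rpred0 add0r subrK.
Qed.

Definition delta : {linear E k p i -> E k p' j} := subquot_map d_Zs d_Bs.

End Differential.

Section Cohomology.
Variables (k : nat) (p n : int).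

Definition cocycles : {pred E k p n} := ker (delta n (n + 1) (erefl (p - k%:Z))).
HB.instance Definition _ := GRing.SubmodClosed.on cocycles.

Definition coboundaries : {pred E k p n} :=
  im (delta (n - 1) n (esym (addrK k%:Z p))).
HB.instance Definition _ := GRing.SubmodClosed.on coboundaries.

Definition HE : lmodType R := subquot cocycles coboundaries.

Lemma coboundaries_sub x : x \in coboundaries -> x \in cocycles.
Proof.
move=> /asboolP[y ->]; apply/eqP; have [u ->] := cls_surj y.
rewrite /delta /= !subquot_mapE; apply: etrans (linear0 cls); congr cls.
by apply: val_inj; rewrite /= fc_dd.
Qed.

End Cohomology.
End SpectralSequence.

Arguments Zs A k p n : clear implicits.
Arguments Bs A k p n : clear implicits.
Arguments E A k p n : clear implicits.
Arguments cocycles A k p n : clear implicits.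
Arguments coboundaries A k p n : clear implicits.
Arguments HE A k p n : clear implicits.
Arguments delta A k {p p'} i j pp'.

Section InducedMap.
Variables (A B : fcomplex) (f : fc_hom A B).

Fact map_Zs (k : nat) (p n : int) x : x \in Zs A k p n -> f n x \in Zs B k p n.
Proof. by move=> /andP[x1 x2]; apply/andP; rewrite -fc_map_d !fc_map_F. Qed.

Variable k : nat.

Fact map_Bs p n x : x \in Bs A k p n -> f n x \in Bs B k p n.
Proof.
case: k => [|m /asboolP[z [w [hz hw ->]]]]; first exact: map_Zs.
apply/asboolP; exists (f n z), (f (n - 1) w).
by rewrite linearD fc_map_d; split=> //; apply: map_Zs.
Qed.

Definition E_map p n : {linear E A k p n -> E B k p n} :=
  subquot_map (@map_Zs k p n) (@map_Bs p n).

Lemma E_map_delta p p' i j (pp' : p' = p - k%:Z) x :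
  E_map p' j (delta A k i j pp' x) = delta B k i j pp' (E_map p i x).
Proof.
have [u ->] := cls_surj x; rewrite /E_map /delta /= !subquot_mapE; congr cls.
by apply: val_inj; rewrite /= fc_map_d.
Qed.

Fact map_cocycles p n x :
  x \in cocycles A k p n -> E_map p n x \in cocycles B k p n.
Proof. by move=> /eqP hx; apply/eqP; rewrite -E_map_delta hx linear0. Qed.

Fact map_coboundaries p n x :
  x \in coboundaries A k p n -> E_map p n x \in coboundaries B k p n.
Proof.
move=> /asboolP[y ->]; apply/asboolP.
by exists (E_map (p + k%:Z) (n - 1) y); rewrite E_map_delta.
Qed.

Definition HE_map p n : {linear HE A k p n -> HE B k p n} :=
  subquot_map (@map_cocycles p n) (@map_coboundaries p n).

End InducedMap.

Definition E_quasi_iso (k : nat) : morphism_class FC :=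
  fun A B f => forall p n : int, bijective (HE_map f k p n).

(** ** Generating cofibrations *)

(* $R$ concentrated in degree [n] is ['rV[R]_(i == n)] in degree [i] (the
   boolean coerces to the rank, 1 or 0). *)
Definition Rdeg (n i : int) : lmodType R := 'rV[R]_(i == n).

(* the identity of $R$, from degree [n] to degree [m] *)
Definition Rid (n m i j : int) : {linear Rdeg n i -> Rdeg m j} :=
  mulmxr (const_mx 1 : 'M[R]_(i == n, j == m)).

Lemma Rid_shape n i j x : j != i + 1 -> Rid n (n + 1) i j x = 0.
Proof.
move=> ne; suff e (b c : bool) (y : 'rV[R]_b) :
  ~~ (b && c) -> y *m (const_mx 1 : 'M[R]_(b, c)) = 0.
  by apply: e; apply: contra ne => /andP[/eqP-> /eqP->].
case: c => [|_]; last exact: thinmx0.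
by case: b y => // y _; rewrite [y]thinmx0 mul0mx.
Qed.

(* the filtration of a module that is pure of weight [w] *)
Definition pure (V : lmodType R) (w p : int) : {pred V} :=
  [pred x | (x == 0) || (w <= p)].
Arguments pure V w p : clear implicits.

Lemma pure_closed V w p : submod_closed (pure V w p).
Proof.
split=> [|a x y]; first by rewrite inE eqxx.
rewrite !inE; case: (w <= p); rewrite ?orbT // !orbF => /eqP-> /eqP->.
by rewrite scaler0 addr0.
Qed.
HB.instance Definition _ V w p :=
  GRing.isSubmodClosed.Build R V (pure V w p) (pure_closed V w p).

Lemma pure_le V w p q x : p <= q -> x \in pure V w p -> x \in pure V w q.
Proof.
by move=> pq /orP[x0|wp]; apply/orP; [left | right; apply: le_trans pq].
Qed.

Lemma pure_map (V W : lmodType R) (f : {linear V -> W}) w w' p x :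
  w' <= w -> x \in pure V w p -> f x \in pure W w' p.
Proof.
move=> ww /orP[/eqP->|wp]; first by rewrite linear0 rpred0.
by apply/orP; right; apply: le_trans wp.
Qed.

Lemma pure0 (V : lmodType R) w p : 0 \in pure V w p.
Proof. exact: rpred0. Qed.

Lemma lin00 (V : lmodType R) (a : R) : 0 = a *: 0 + 0 :> V.
Proof. by rewrite scaler0 addr0. Qed.

Section Zcomplex.
Variables (k : nat) (p n : int).

Definition Z_mod (i : int) : lmodType R := (Rdeg n i * Rdeg (n + 1) i)%type.

Definition Z_d (i j : int) (x : Z_mod i) : Z_mod j :=
  (0, Rid n (n + 1) i j x.1).

Fact Z_d_linear i j : linear (@Z_d i j).
Proof.
by move=> a x y; congr pair; [apply: lin00 | apply: linearP].
Qed.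
HB.instance Definition _ i j :=
  GRing.isLinear.Build R (Z_mod i) (Z_mod j) _ (@Z_d i j) (@Z_d_linear i j).

Definition Z_filt (q i : int) : {pred Z_mod i} :=
  [pred x | (x.1 \in pure (Rdeg n i) p q) &&
            (x.2 \in pure (Rdeg (n + 1) i) (p - k%:Z) q)].

(* R^n_(p) --1--> R^(n+1)_(p-k) *)
Program Definition Zcx : fcomplex := @FComplex Z_mod (@Z_d) Z_filt _ _ _ _ _.
Next Obligation. by move=> i j x ne; congr pair; apply: Rid_shape. Qed.
Next Obligation. by move=> i j m x; congr pair; apply: linear0. Qed.
Next Obligation.
move=> q i; split=> [|a x y /andP[x1 x2] /andP[y1 y2]].
  by apply/andP; rewrite !rpred0.
by apply/andP; rewrite !rpredD ?rpredZ.
Qed.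
Next Obligation.
move=> q i x /andP[x1 x2]; apply/andP.
by split; [move: x1|move: x2]; apply: pure_le; rewrite gerBl.
Qed.
Next Obligation.
move=> q i x /andP[x1 x2]; apply/andP; rewrite rpred0; split=> //.
by move: x1; apply: pure_map; rewrite gerBl.
Qed.

End Zcomplex.

(* [Bcx k p n] is $\mathcal{B}_{k+1}(p,n)$; there is no $\mathcal{B}_0$ *)
Section Bcomplex.
Variables (k : nat) (p n : int).
Local Notation k1 := (k.+1%:Z).

Definition B_mod (i : int) : lmodType R :=
  (Rdeg (n - 1) i * (Rdeg n i * Rdeg n i) * Rdeg (n + 1) i)%type.

Definition B_d (i j : int) (x : B_mod i) : B_mod j :=
  (0, (Rid (n - 1) n i j x.1.1, 0), Rid n (n + 1) i j x.1.2.2).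

Fact B_d_linear i j : linear (@B_d i j).
Proof.
by move=> a x y; congr (_, (_, _), _); [exact: lin00 | exact: linearP
  | exact: lin00 | exact: linearP].
Qed.
HB.instance Definition _ i j :=
  GRing.isLinear.Build R (B_mod i) (B_mod j) _ (@B_d i j) (@B_d_linear i j).

Definition B_filt (q i : int) : {pred B_mod i} :=
  [pred x | [&& x.1.1 \in pure (Rdeg (n - 1) i) (p + k1 - 1) q,
                x.1.2.1 \in pure (Rdeg n i) p q,
                x.1.2.2 \in pure (Rdeg n i) (p - 1) q
              & x.2 \in pure (Rdeg (n + 1) i) (p - k1) q]].

(* R^(n-1)_(p+k) --> R^n_(p) (+) R^n_(p-1) --> R^(n+1)_(p-k-1) *)
Program Definition Bcx : fcomplex := @FComplex B_mod (@B_d) B_filt _ _ _ _ _.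
Next Obligation.
move=> i j x ne; congr (_, (_, _), _); last exact: Rid_shape.
have := @Rid_shape (n - 1) i j x.1.1 ne; rewrite /Rid /Rdeg subrK; exact.
Qed.
Next Obligation.
by move=> i j m x; congr (_, (_, _), _); apply: linear0.
Qed.
Next Obligation.
move=> q i; split=> [|a x y /and4P[x1 x2 x3 x4] /and4P[y1 y2 y3 y4]].
  by apply/and4P; rewrite !rpred0.
by apply/and4P; split; apply: rpredD => //; apply: rpredZ.
Qed.
Next Obligation.
move=> q i x /and4P[x1 x2 x3 x4]; apply/and4P.
split; [move: x1|move: x2|move: x3|move: x4].
all: by apply: pure_le; rewrite gerBl.
Qed.
Next Obligation.
move=> q i x /and4P[x1 x2 x3 x4]; apply/and4P; split; rewrite ?rpred0 //.
  by move: x1; apply: pure_map; lia.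
by move: x3; apply: pure_map; lia.
Qed.

End Bcomplex.

Section Generators.
Variables (k : nat) (p n : int).

Definition phi_map (i : int) (x : Z_mod n i) : B_mod n i :=
  (0, (x.1, x.1), x.2).

Fact phi_linear i : linear (@phi_map i).
Proof.
by move=> a x y; congr (_, (_, _), _); apply: lin00.
Qed.
HB.instance Definition _ i :=
  GRing.isLinear.Build R (Z_mod n i) (B_mod n i) _ (@phi_map i) (@phi_linear i).

(* [phi k p n] is $\varphi_{k+1} : \mathcal{Z}_{k+1}(p,n) \to
   \mathcal{B}_{k+1}(p,n)$ *)
Program Definition phi : fc_hom (Zcx k.+1 p n) (Bcx k p n) :=
  @FCHom (Zcx k.+1 p n) (Bcx k p n) (@phi_map) _ _.
Next Obligation.
by move=> i j x; congr (_, (_, _), _); apply: (esym (linear0 _)).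
Qed.
Next Obligation.
move=> q i x /andP[x1 x2]; apply/and4P; split=> //; first exact: rpred0.
by move: x1; apply: (@pure_map _ _ idfun); rewrite gerBl.
Qed.

End Generators.

Program Definition fc0 : fcomplex :=
  @FComplex (fun _ => 'rV[R]_0 : lmodType R) (fun _ _ => \0)
    (fun _ _ => predT) _ _ _ _ _.
Next Obligation. by []. Qed.
Next Obligation. by []. Qed.
Next Obligation. by []. Qed.
Next Obligation. by []. Qed.
Next Obligation. by []. Qed.

Program Definition fc_from0 (A : fcomplex) : fc_hom fc0 A :=
  @FCHom fc0 A (fun _ => \0) _ _.
Next Obligation. by move=> A i j x; apply: (esym (linear0 _)). Qed.
Next Obligation. by move=> A p n x _; apply: rpred0. Qed.

Variant I_set (k : nat) : forall A B : FC, A ~> B -> Prop :=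
  I_gen (p n : int) : @I_set k (Zcx k.+1 p n) (Bcx k p n) (phi k p n).

Variant J_set (k : nat) : forall A B : FC, A ~> B -> Prop :=
  J_gen (p n : int) : @J_set k fc0 (Zcx k p n) (fc_from0 (Zcx k p n)).

End FilteredComplexes.

Arguments FC R : clear implicits.
Arguments Shift R l : clear implicits.
Arguments Dec R l : clear implicits.
Arguments ShiftDec R l : clear implicits.
Arguments E_quasi_iso R k : clear implicits.
Arguments I_set R k : clear implicits.
Arguments J_set R k : clear implicits.

(* Main.v *)
(** A morphism is an E_k-quasi-isomorphism if and only if E_(k+1)(f) is an
    isomorphism. For pages of index at least 1, page k of A and page l+k of
    S^l A coincide after reindexing, and so do page k of Dec^l Y and page l+k
    of Y. Transposition being the identity on underlying maps, a morphism
    S^l X -> Y is a weak equivalence exactly when its transpose X -> Dec^l Y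
    is, with no condition on X or Y. Taking Y = S^l X, this also makes S^l
    preserve weak equivalences. Finally S^l carries phi_(r+1)(p,n) to an
    isomorphic copy of phi_(l+r+1)(p-ln,n), so Dec^l preserves trivial
    fibrations and S^l preserves cofibrations. *)
Require Import Defs.
From mathcomp Require Import all_boot all_algebra.
From mathcomp Require Import all_order boolp zify.

Set Implicit Arguments.
Unset Strict Implicit.
Unset Printing Implicit Defensive.

Import Order.TTheory GRing.Theory Num.Theory.
Local Open Scope ring_scope.
Local Open Scope cat_scope.

#[local] Arguments Zs {R} A k p n.
#[local] Arguments Bs {R} A k p n.
#[local] Arguments cocycles {R} A k p n.
#[local] Arguments coboundaries {R} A k p n.
#[local] Arguments delta {R} A k {p p'} i j pp'.
#[local] Arguments pure {R} V w p.

(** * Lifting properties, retracts and adjunctions *)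

Lemma has_lift_retract (C : category) (A B A' B' X Y : C)
    (f : A ~> B) (g : A' ~> B') (p : X ~> Y) :
  retract f g -> has_lift g p -> has_lift f p.
Proof.
move=> [i [r [j [s [ri sj gi fr]]]]] lift_gp u v puvf.
have [|h [hg ph]] := lift_gp (u ∘ r) (v ∘ s).
  by rewrite cmpA puvf -!cmpA fr.
exists (h ∘ j); split; first by rewrite -cmpA -gi cmpA hg -cmpA ri cmpm1.
by rewrite cmpA ph -cmpA sj cmpm1.
Qed.

(** Retract argument: factor [i] as a cofibration [j] followed by a trivial fibration [p]; a lift of
    [i] against [p] exhibits [i] as a retract of [j]. *)
Lemma cof_llp (C : category) (M : model_structure C) (A B : C) (i : A ~> B) :
  (forall (X Y : C) (p : X ~> Y), meet_class (@fib C M) (@weq C M) p -> has_lift i p) ->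
  cof M i.
Proof.
move=> llp_i; have [W [j [p [cof_j tfib_p ipj]]]] := cof_tfib_fact M i.
have [|h [hi ph]] := llp_i _ _ p tfib_p j (idm B); first by rewrite cmp1m.
apply: cof_retract cof_j; exists (idm A), (idm A), h, p.
by split; rewrite ?cmp1m ?cmpm1.
Qed.

Section Adjunction.
Variables (C D : category) (F : functor C D) (G : functor D C).
Variable phi : adjunction F G.

Lemma has_lift_adj (A B : C) (X Y : D) (i : A ~> B) (p : X ~> Y) :
  has_lift (fhom F i) p -> has_lift i (fhom G p).
Proof.
move=> lift_ip u v puvi.
have [g gK Kg] := adj_bij phi A X; have [g' g'K Kg'] := adj_bij phi B Y.
have [|h [hi ph]] := lift_ip (g u) (g' v).
  by apply: (bij_inj (adj_bij phi A Y)); rewrite adj_natr adj_natl Kg Kg'.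
exists (adj phi h); split; first by rewrite -adj_natl hi Kg.
by rewrite -adj_natr ph Kg'.
Qed.

Lemma has_lift_unadj (A B : C) (X Y : D) (i : A ~> B) (p : X ~> Y) :
  has_lift i (fhom G p) -> has_lift (fhom F i) p.
Proof.
move=> lift_ip u v puvi.
have [g gK Kg] := adj_bij phi B X.
have [|h [hi ph]] := lift_ip (adj phi u) (adj phi v).
  by rewrite -adj_natr puvi adj_natl.
exists (g h); split; apply: (bij_inj (adj_bij phi _ _)).
  by rewrite adj_natl Kg.
by rewrite adj_natr Kg.
Qed.

Variables (M : model_structure C) (N : model_structure D).
Variables (I J E : morphism_class C) (I' J' E' : morphism_class D).
Hypothesis gen_M : cofibrantly_generated_by M I J E.
Hypothesis gen_N : cofibrantly_generated_by N I' J' E'.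

(** Transposing lifting problems reduces the claim to [G] preserving trivial fibrations, which is
    tested on [I]. A retract suffices, since lifting passes to retracts; this covers an [F i] that
    is a generator only up to isomorphism. *)
Lemma left_adjoint_cof :
  (forall (A B : C) (i : A ~> B), I i ->
     exists (A' B' : D) (i' : A' ~> B'), retract (fhom F i) i' /\ I' i') ->
  forall (A B : C) (f : A ~> B), cof M f -> cof N (fhom F f).
Proof.
move=> FI A B f cof_f; apply: cof_llp => X Y p tfib_p.
apply: has_lift_unadj; apply: (cof_tfib_lift cof_f).
have [_ _ tfibM] := gen_M; have [_ _ tfibN] := gen_N.
apply/tfibM => A' B' i /FI[A'' [B'' [i' [ret Ii']]]].
apply: has_lift_adj; apply: has_lift_retract ret _.
by move/tfibN: tfib_p; apply.
Qed.

(* The adjunct of [F f] is [f] followed by the unit, which is the adjunct of an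
   identity. *)
Lemma left_adjoint_weq :
  (forall (X : C) (Y : D) (f : F X ~> Y), weq N f <-> weq M (adj phi f)) ->
  forall (X Y : C) (f : X ~> Y), weq M f -> weq N (fhom F f).
Proof.
move=> weq_adj X Y f weq_f.
apply/weq_adj; rewrite -[fhom F f]cmp1m adj_natl.
apply: (weq_subcat M).2 => //.
by apply/weq_adj; apply: (weq_subcat N).1.
Qed.

Lemma quillen_equivalence_of_adj :
  (forall (A B : C) (i : A ~> B), I i ->
     exists (A' B' : D) (i' : A' ~> B'), retract (fhom F i) i' /\ I' i') ->
  (forall (X : C) (Y : D) (f : F X ~> Y), weq N f <-> weq M (adj phi f)) ->
  quillen_equivalence M N phi.
Proof.
move=> FI weq_adj; split=> [|X Y f _ _]; last exact: weq_adj.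
split=> X Y f; first exact: left_adjoint_cof.
by case=> cof_f weq_f; split; [apply: left_adjoint_cof|apply: left_adjoint_weq].
Qed.

End Adjunction.

(** * Bijectivity of maps between subquotients *)

Lemma bijectiveP (S T : Type) (f : S -> T) :
  bijective f <-> injective f /\ forall y, exists x, y = f x.
Proof.
split=> [[g fK gK]|[inj_f surj_f]].
  by split=> [|y]; [apply: can_inj fK|exists (g y)].
have gP y := cid (surj_f y).
exists (fun y => sval (gP y)) => [x|y]; last by rewrite -(svalP (gP y)).
by apply: inj_f; rewrite -(svalP (gP _)).
Qed.

Lemma submodB (R : pzRingType) (V : lmodType R) (Z : submodClosed V) (x y : V) :
  x \in Z -> y \in Z -> x - y \in Z.
Proof. by move=> Zx Zy; rewrite -scaleN1r rpredD ?rpredZ. Qed.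

(** This trades bijectivity between quotient types for membership conditions on representatives, so
    that pages can be compared without building isomorphisms between them. *)
Lemma subquot_map_bijP (R : pzRingType) (V W : lmodType R) (f : {linear V -> W})
    (Z B : submodClosed V) (Z' B' : submodClosed W)
    (fZ : forall x, x \in Z -> f x \in Z') (fB : forall x, x \in B -> f x \in B') :
  bijective (subquot_map fZ fB) <->
  (forall x, x \in Z -> f x \in B' -> x \in B) /\
  (forall y, y \in Z' -> exists2 x, x \in Z & y - f x \in B').
Proof.
split=> [/bijectiveP[inj_f surj_f]|[inj_f surj_f]]; last apply/bijectiveP.
  split=> [x Zx fx|y Zy].
    have: cls (exist _ x Zx : submod Z) = cls 0 :> subquot Z B.
      apply: inj_f; rewrite !subquot_mapE; apply/cls_eq => /=.
      by rewrite linear0 subr0.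
    by move/cls_eq => /=; rewrite subr0.
  have [x] := surj_f (cls (exist _ y Zy : submod Z')).
  have [u ->] := cls_surj x; rewrite subquot_mapE => /cls_eq /= fu.
  by exists (val u) => //; apply: valP.
split=> [x y|y].
  have [u ->] := cls_surj x; have [v ->] := cls_surj y.
  rewrite !subquot_mapE => /cls_eq /=; rewrite -linearB => fuv.
  by apply/cls_eq; apply: inj_f => //; apply: submodB; apply: valP.
have [v ->] := cls_surj y; have [x Zx vx] := surj_f (val v) (valP v).
exists (cls (exist _ x Zx : submod Z)); rewrite subquot_mapE.
by apply/cls_eq.
Qed.

(** * Cohomology of a page against the next page *)

Section Pages.
Variable R : comPzRingType.
Implicit Types A B : fcomplex R.

Local Notation d := (@fc_d R _).

Lemma delta_cls A k p p' i j (e : p' = p - k%:Z) (u : submod (Zs A k p i)) :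
  delta A k i j e (cls u) = cls (submod_map (@d_Zs R A k p p' i j e) u).
Proof. exact: subquot_mapE. Qed.

Lemma cocycleP A k p n (u : submod (Zs A k p n)) :
  (cls u \in cocycles A k p n) <->
  d n (n + 1) (val u) \in Bs A k (p - k%:Z) (n + 1).
Proof.
rewrite inE delta_cls; split=> [/eqP|h].
  rewrite -[0](linear0 cls) => /cls_eq /=; by rewrite subr0.
by apply/eqP; rewrite -[0](linear0 cls); apply/cls_eq; rewrite subr0.
Qed.

Lemma coboundaryP A k p n (u : submod (Zs A k p n)) :
  (cls u \in coboundaries A k p n) <->
  exists2 w, w \in Zs A k (p + k%:Z) (n - 1) &
    val u - d (n - 1) n w \in Bs A k p n.
Proof.
split=> [/asboolP[y]|[w Zw uw]].
  have [w ->] := cls_surj y; rewrite delta_cls => /cls_eq uw.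
  by exists (val w); first exact: valP.
apply/asboolP; exists (cls (exist _ w Zw : submod _)).
by rewrite delta_cls; apply/cls_eq.
Qed.


(** $Z_k^{p-1}$ lies in $Z_{k-1}^{p-1}$, the first summand of $B_k^p$; for [k = 0] it is $B_0^p$
    itself. *)
Lemma Zs_pred_Bs A k p n x : x \in Zs A k (p - 1) n -> x \in Bs A k p n.
Proof.
case: k => // k /andP[x1 x2]; apply/asboolP; exists x, 0.
rewrite linear0 addr0 rpred0; split=> //; apply/andP; split=> //.
by move: x2; apply: fc_le; lia.
Qed.

(** The degree [i] is tied by an equation so that in degree [n + 1] one can take [i := n] without
    transport. *)
Lemma BsP A k p n i x : i = n - 1 ->
  x \in Bs A k.+1 p n <->
  exists z w, [/\ z \in Zs A k (p - 1) n, w \in Zs A k (p + k%:Z) i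
    & x = z + d i n w].
Proof.
move=> ->; have -> : p + k%:Z = p + k.+1%:Z - 1 by lia.
by split=> /asboolP.
Qed.

Lemma Zs_succ A k p n x :
  x \in Zs A k.+1 p n ->
  x \in Zs A k p n /\ d n (n + 1) x \in Bs A k (p - k%:Z) (n + 1).
Proof.
move=> /andP[x1 x2]; split.
  by apply/andP; split=> //; move: x2; apply: fc_le; lia.
apply: Zs_pred_Bs; apply/andP; rewrite fc_dd rpred0; split=> //.
by move: x2; apply: fc_le; lia.
Qed.

(** Cocycles of $E_k$ have representatives in $Z_{k+1}$: for [k > 0] write $dx = z + dw$ as an
    element of $B_k^{p-k}$; then $w$ lies in $Z_{k-1}^{p-1}$, hence in $B_k^p$, and $d(x-w) = z$ has
    weight $p-k-1$. *)
Lemma cocycle_decomp A k p n x :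
  x \in Zs A k p n -> d n (n + 1) x \in Bs A k (p - k%:Z) (n + 1) ->
  exists2 y, y \in Zs A k.+1 p n & x - y \in Bs A k p n.
Proof.
case: k => [|k] Zx dx.
  exists x; last by rewrite subrr rpred0.
  case/andP: Zx dx => x1 _ /andP[x2 _]; apply/andP; split=> //.
  by move: x2; apply: fc_le; lia.
have [|z [w [/andP[z1 _] Zw dxE]]] :=
    (BsP k (p - k.+1%:Z) (i := n) (d n (n + 1) x) _).1 dx.
  by rewrite addrK.
have {}Zw : w \in Zs A k (p - 1) n.
  by have -> : p - 1 = p - k.+1%:Z + k%:Z by lia.
exists (x - w); last first.
  rewrite subKr; apply/BsP; first exact: erefl.
  by exists w, 0; rewrite rpred0 linear0 addr0.
case/andP: Zx Zw => x1 _ /andP[w1 _]; apply/andP; split.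
  by apply: submodB => //; apply: fc_mono.
by rewrite linearB dxE addrK /=; move: z1; apply: fc_le; lia.
Qed.

(** With [cocycle_decomp] this identifies $H(E_k)$ with $Z_{k+1}/B_{k+1}$. The boundary part of
    $B_k$ is absorbed into $dZ_k^{p+k}$. *)
Lemma Bs_succP A k p n x :
  x \in Zs A k.+1 p n ->
  (exists2 w, w \in Zs A k (p + k%:Z) (n - 1) &
     x - d (n - 1) n w \in Bs A k p n)
  <-> x \in Bs A k.+1 p n.
Proof.
have ii : n - 1 + 1 = n by rewrite subrK.
move=> /andP[x1 x2]; split=> [[w Zw]|/(BsP _ _ _ erefl)[z [w [Zz Zw ->]]]]; last first.
  by exists w => //; rewrite addrK; apply: Zs_pred_Bs.
case: k => [|k] in x2 Zw *.
  move=> Zz; apply/(BsP _ _ _ erefl).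
  by exists (x - d (n - 1) n w), w; rewrite subrK.
move=> /(BsP _ _ _ erefl)[z [w' [Zz Zw' xE]]].
apply/(BsP _ _ _ erefl); exists z, (w + w'); split; last first.
- by rewrite linearD addrCA -xE subrKC.
- rewrite rpredD //; case/andP: Zw' => w1 w2; apply/andP; split.
    by move: w1; apply: fc_le; lia.
  by move: w2; apply: fc_le; lia.
case/andP: Zz => z1 _; apply/andP; split=> //.
(* [z] differs from [x] by boundaries, so it inherits from [x] the extra drop in weight. *)
have -> : d n (n + 1) z = d n (n + 1) x.
  have -> : x = z + d (n - 1) n w' + d (n - 1) n w by rewrite -xE subrK.
  by rewrite !linearD !fc_dd !addr0.
by move: x2; apply: fc_le; lia.
Qed.

Lemma cocycle_rep A k p n (x : E A k p n) :
  x \in cocycles A k p n ->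
  exists2 u : submod (Zs A k p n), x = cls u & val u \in Zs A k.+1 p n.
Proof.
have [u ->] := cls_surj x; move/cocycleP => /(cocycle_decomp (valP u))[y Zy uy].
exists (exist _ y (Zs_succ Zy).1); last exact: Zy.
exact/cls_eq.
Qed.

Lemma E_map_cls A B (f : fc_hom A B) k p n (u : submod (Zs A k p n)) :
  E_map f k p n (cls u) = cls (submod_map (@map_Zs _ _ _ f k p n) u).
Proof. exact: subquot_mapE. Qed.

(** Both bijectivity conditions are read on representatives in $Z_{k+1}$, where they agree by
    [cocycle_rep] and [Bs_succP]. *)
Lemma E_quasi_isoP A B (f : fc_hom A B) k :
  @E_quasi_iso R k A B f <-> forall p n, bijective (E_map f k.+1 p n).
Proof.
have fcls p n (u : submod (Zs A k p n)) :
    val u \in Zs A k.+1 p n ->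
    E_map f k p n (cls u) \in coboundaries B k p n <->
    f n (val u) \in Bs B k.+1 p n.
  by move=> Zu; rewrite E_map_cls coboundaryP -Bs_succP //=; apply: map_Zs.
suff Efn p n : bijective (HE_map f k p n) <-> bijective (E_map f k.+1 p n).
  by split=> h p n; apply/Efn.
split=> /subquot_map_bijP[inj_f surj_f]; apply/subquot_map_bijP; split.
- move=> x Zx fx; apply/(Bs_succP Zx).
  pose u : submod (Zs A k p n) := exist _ x (Zs_succ Zx).1.
  apply/(coboundaryP u)/inj_f; last exact/fcls.
  by apply/cocycleP; apply: (Zs_succ Zx).2.
- move=> y Zy; pose v : submod (Zs B k p n) := exist _ y (Zs_succ Zy).1.
  have [|x cx] := surj_f (cls v); first by apply/cocycleP/(Zs_succ Zy).2.
  have [u -> Zu] := cocycle_rep cx; rewrite E_map_cls -linearB => /coboundaryP uv.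
  exists (val u) => //; apply/Bs_succP; last exact: uv.
  by apply: submodB => //; apply: map_Zs.
- move=> x /cocycle_rep[u -> Zu] /(fcls _ _ _ Zu) fu.
  by apply/coboundaryP/Bs_succP/inj_f.
move=> y /cocycle_rep[v -> Zv]; have [x Zx vx] := surj_f _ Zv.
pose u : submod (Zs A k p n) := exist _ x (Zs_succ Zx).1.
exists (cls u); first by apply/cocycleP; apply: (Zs_succ Zx).2.
rewrite E_map_cls -linearB; apply/coboundaryP/Bs_succP => //.
by apply: submodB => //; apply: map_Zs.
Qed.

End Pages.

(** * Pages and generators under shift and décalage *)

Section ShiftDecalage.
Variables (R : comPzRingType) (l : nat).
Implicit Types (A X Y : fcomplex R) (k : nat) (p n : int).

(** The shift moves weights by $l(n+1)$ in degree $n+1$, which is $l$ more than in degree $n$; the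
    page index [l + k] absorbs the difference. *)
Lemma Zs_shift A k p n x :
  (x \in Zs (shift l A) (l + k) p n) = (x \in Zs A k (p + l%:Z * n) n).
Proof.
rewrite !inE /=; by congr (_ && (_ \in @fc_filt _ A _ _)); lia.
Qed.

Lemma Bs_shift A k p n x :
  (x \in Bs (shift l A) (l + k).+1 p n) = (x \in Bs A k.+1 (p + l%:Z * n) n).
Proof.
apply/asboolP/asboolP => -[z [w [Zz Zw ->]]]; exists z, w; split=> //.
- by move: Zz; rewrite Zs_shift addrAC.
- by move: Zw; rewrite Zs_shift; congr (_ \in Zs A k _ _); lia.
- by rewrite Zs_shift addrAC.
- by rewrite Zs_shift; move: Zw; congr (_ \in Zs A k _ _); lia.
Qed.

(** The décalage asks for $dx \in F_{p-l}$, which follows from the page condition $dx \in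
    F_{p-l-k}$. *)
Lemma Zs_dec A k p n x :
  (x \in Zs (dec l A) k (p + l%:Z * n) n) = (x \in Zs A (l + k) p n).
Proof.
apply/idP/idP => [/andP[/andP[x1 _] /andP[x2 _]]|/andP[x1 x2]].
  apply/andP; split; [move: x1|move: x2]; apply: fc_le; lia.
apply/andP; split; apply/andP; split; rewrite ?fc_dd ?rpred0 //.
- by move: x1; apply: fc_le; lia.
- by move: x2; apply: fc_le; lia.
- by move: x2; apply: fc_le; lia.
Qed.

(* This fails for page 0 of the décalage: [Bs (dec l A) 0] and [Bs A l] differ,
   and page 0 of [dec l A] is only quasi-isomorphic to page [l] of [A]. *)
Lemma Bs_dec A k p n x :
  (x \in Bs (dec l A) k.+1 (p + l%:Z * n) n) = (x \in Bs A (l + k).+1 p n).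
Proof.
have e1 : p + l%:Z * n - 1 = p - 1 + l%:Z * n by lia.
have e2 : p + l%:Z * n + k.+1%:Z - 1 =
          p + (l + k).+1%:Z - 1 + l%:Z * (n - 1) by lia.
by apply/asboolP/asboolP => -[z [w [Zz Zw ->]]]; exists z, w; split=> //;
  move: Zz Zw; rewrite ?e1 ?e2 !Zs_dec.
Qed.

Lemma E_quasi_iso_adj X Y k (f : fc_hom (shift l X) Y) :
  @E_quasi_iso R (l + k) _ _ f <-> @E_quasi_iso R k _ _ (shift_adj f).
Proof.
rewrite !E_quasi_isoP.
suff fE p n : bijective (E_map f (l + k).+1 p n) <->
    bijective (E_map (shift_adj f) k.+1 (p + l%:Z * n) n).
  (* For fixed [n], translation by $ln$ is a bijection of the weights [p]. *)
  by split=> h p n; [rewrite -[p](subrK (l%:Z * n))|]; apply/fE.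
have ZX x : (x \in Zs (shift l X) (l + k).+1 p n) =
    (x \in Zs X k.+1 (p + l%:Z * n) n) by rewrite -addnS Zs_shift.
have ZY y : (y \in Zs (dec l Y) k.+1 (p + l%:Z * n) n) =
    (y \in Zs Y (l + k).+1 p n) by rewrite Zs_dec addnS.
split=> /subquot_map_bijP[inj_f surj_f]; apply/subquot_map_bijP; split.
- by move=> x; rewrite -ZX -Bs_shift Bs_dec; apply: inj_f.
- move=> y; rewrite ZY => /surj_f[x Zx yx].
  by exists x; rewrite -?ZX ?Bs_dec.
- by move=> x; rewrite ZX Bs_shift -Bs_dec; apply: inj_f.
- move=> y; rewrite -ZY => /surj_f[x Zx yx].
  by exists x; rewrite ?ZX -?Bs_dec.
Qed.

(** Outside degree [m] the module is zero, so weights matter only at [i = m]. There the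
    degree-dependent shift $li$ becomes the constant $lm$. *)
Lemma pure_Rdeg m i w w' q q' (x : Rdeg R m i) :
  (i = m -> (w <= q) = (w' <= q')) ->
  (x \in pure (Rdeg R m i) w q) = (x \in pure (Rdeg R m i) w' q').
Proof.
have [im e|ne _] := eqVneq i m; first by rewrite !inE e.
suff -> : x = 0 by rewrite !inE eqxx.
by move: x; rewrite /Rdeg (negbTE ne) => x; apply: thinmx0.
Qed.

Lemma shift_Zcx_filt k p n q i (x : Z_mod R n i) :
  (x \in @fc_filt R (shift l (Zcx R k p n)) q i) =
  (x \in @fc_filt R (Zcx R (l + k) (p - l%:Z * n) n) q i).
Proof.
by rewrite !inE; congr (_ && _); apply: pure_Rdeg => ->; lia.
Qed.

Lemma shift_Bcx_filt k p n q i (x : B_mod R n i) :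
  (x \in @fc_filt R (shift l (Bcx R k p n)) q i) =
  (x \in @fc_filt R (Bcx R (l + k) (p - l%:Z * n) n) q i).
Proof.
by rewrite !inE; congr [&& _, _, _ & _]; apply: pure_Rdeg => ->; lia.
Qed.

(** Both sides share modules and differentials, and their filtrations have the same members;
    identity maps in both directions give the isomorphism, recorded as a retract. *)
Lemma shift_phi_retract k p n :
  @retract (FC R) _ _ _ _ (fhom (Shift R l) (phi R k p n))
    (phi R (l + k) (p - l%:Z * n) n).
Proof.
have Zfilt q i x := @shift_Zcx_filt k.+1 p n q i x; rewrite addnS in Zfilt.
have Bfilt q i x := @shift_Bcx_filt k p n q i x.
pose Z1 := shift l (Zcx R k.+1 p n).
pose Z2 := Zcx R (l + k).+1 (p - l%:Z * n) n.
pose B1 := shift l (Bcx R k p n).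
pose B2 := Bcx R (l + k) (p - l%:Z * n) n.
exists (@FCHom R Z1 Z2 (fun=> idfun) (fun _ _ _ => erefl)
  (fun q i x => etrans (esym (Zfilt q i x)))).
exists (@FCHom R Z2 Z1 (fun=> idfun) (fun _ _ _ => erefl)
  (fun q i x => etrans (Zfilt q i x))).
exists (@FCHom R B1 B2 (fun=> idfun) (fun _ _ _ => erefl)
  (fun q i x => etrans (esym (Bfilt q i x)))).
exists (@FCHom R B2 B1 (fun=> idfun) (fun _ _ _ => erefl)
  (fun q i x => etrans (Bfilt q i x))).
by split; apply: fc_hom_eq.
Qed.

End ShiftDecalage.

Theorem theorem3p21 (R : comPzRingType) (l r : nat)
    (M : model_structure (FC R)) (N : model_structure (FC R))
    (hM : cofibrantly_generated_by M (I_set R r) (J_set R r) (E_quasi_iso R r))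
    (hN : cofibrantly_generated_by N (I_set R (l + r)) (J_set R (l + r))
            (E_quasi_iso R (l + r))) :
  quillen_equivalence M N (ShiftDec R l).
Proof.
apply: (quillen_equivalence_of_adj hM hN) => [_ _ _ [p n]|X Y f].
  (* In degree [n], $S^l$ turns pure weight $p$ into $p - ln$. *)
  exists _, _, (phi R (l + r) (p - l%:Z * n) n).
  by split; first exact: shift_phi_retract.
have [weqM _ _] := hM; have [weqN _ _] := hN.
by rewrite weqM weqN; apply: E_quasi_iso_adj.
Qed.
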